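(* Let $G$ be a complete geometric graph with $n\geq 3$ vertices (in general position in the plane). If $c$ is a colouring of the edges of $G$ using exactly $\binom{n}{2}-n+2$ colours, then $G$ has a heterochromatic plane spanning tree.
   Context: The complete geometric graph on a set $P$ of points in general position in the plane is the graph with vertex set $P$ whose edges are all straight line segments joining two points of $P$. A plane spanning tree is a spanning tree whose edges (as segments) pairwise do not cross. A subgraph is heterochromatic under an edge colouring if its edges receive pairwise distinct colours. *)

(* Defs.v *)
(* MathComp / MathComp-Analysis; the plane is 'rV[R]_2 for R : realType *)
From mathcomp Require Import all_boot all_order all_algebra.
From mathcomp Require Import classical_sets reals.

Set Implicit Arguments.
Unset Strict Implicit.
Unset Printing Implicit Defensive.

Import Order.TTheory GRing.Theory Num.Theory.

Local Open Scope ring_scope.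

Section Plane.
Variable R : realType.
Implicit Types p q r x d : 'rV[R]_2.

Definition line p d : set 'rV[R]_2 := [set p + t *: d | t in setT]%classic.

Definition collinear p q r : Prop :=
  exists a d, [/\ d != 0, line a d p, line a d q & line a d r].

Definition segment p q : set 'rV[R]_2 :=
  [set (1 - t) *: p + t *: q | t in [set t : R | 0 <= t <= 1]]%classic.

End Plane.

Section CompleteGraph.
Variable V : finType.
Implicit Types (T : {set {set V}}) (i j : V).

Definition edges : {set {set V}} := [set e : {set V} | #|e| == 2%N].

Definition adj T : rel V := fun i j => [set i; j] \in T.

Definition connected T : Prop := forall i j, connect (adj T) i j.

(* adj T is symmetric, so a walk back and forth along one edge is a ucycle of
   size 2; the cycles of the graph are the ucycles of size at least 3 *)
Definition acyclic T : Prop :=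
  forall s : seq V, ucycle (adj T) s -> (size s <= 2)%N.

Definition spanning_tree T : Prop :=
  [/\ T \subset edges, connected T & acyclic T].

Definition heterochromatic (C : finType) (c : {set V} -> C) T : Prop :=
  {in T &, injective c}.

End CompleteGraph.

Arguments edges : clear implicits.

Section GeometricGraph.
Variables (R : realType) (V : finType).
(* pt i is the point of the plane at which the vertex i is placed *)
Variable pt : V -> 'rV[R]_2.
Implicit Types (e f : {set V}) (T : {set {set V}}).

Definition general_position : Prop :=
  injective pt /\
  forall i j k, i != j -> j != k -> i != k ->
    ~ collinear (pt i) (pt j) (pt k).

Definition edge_segment e : set 'rV[R]_2 :=
  [set x | exists i j, e = [set i; j]%SET /\ segment (pt i) (pt j) x]%classic.

Definition crossing e f : Prop :=
  exists x, [/\ edge_segment e x, edge_segment f x &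
                ~ exists2 i, i \in e :&: f & x = pt i].

Definition plane T : Prop :=
  {in T &, forall e f, e != f -> ~ crossing e f}.

End GeometricGraph.

(* Main.v *)
(* Keep one edge of each colour: at most n - 2 edges are omitted, so the
   omitted graph F is disconnected, and the vertices carry a non-constant
   labelling that is constant along the edges of F.  It then suffices to find a
   plane connected graph all of whose edges join differently labelled points.
   Cut a point set S by the line through two differently labelled points v and
   q.  On each closed side, let A be the set of points of S other than v: if A
   has two labels, add the edge vq to a graph obtained by induction on A;
   otherwise all of A is labelled as q, and the star from v to A works.  The two
   graphs meet the line only in v, in q, or along the common edge vq. *)
Require Import Defs.
From mathcomp Require Import all_boot all_order all_algebra.
From mathcomp Require Import reals.
From mathcomp Require Import ring lra zify.

Set Implicit Arguments.
Unset Strict Implicit.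
Unset Printing Implicit Defensive.

Import Order.TTheory GRing.Theory Num.Theory.

(** * Spanning trees and vertex labellings of finite graphs *)

Section Graph.
Variable V : finType.
Implicit Types (T F : {set {set V}}) (S : {set V}) (i j : V).

Definition spans T S : Prop := {in S &, forall i j, connect (adj T) i j}.

Lemma connect_adj_sym T : connect_sym (adj T).
Proof. by apply: sym_connect_sym => i j; rewrite /adj setUC. Qed.

Lemma connect_adjS T F i j :
  T \subset F -> connect (adj T) i j -> connect (adj F) i j.
Proof.
move=> sTF; apply: (connect_sub (e := adj T)) => x y xy.
by apply: connect1; apply: (subsetP sTF).
Qed.

Lemma spans_root T S v :
  {in S, forall i, connect (adj T) v i} -> spans T S.
Proof.
move=> cT i j iS jS; apply: connect_trans (cT j jS).
by rewrite connect_adj_sym cT.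
Qed.

(** The rest of the cycle, from [y] through [s] and back to [x], avoids the edge between [x] and
    [y]. A non-empty [s] rules out the walk back and forth along that edge. *)
Lemma cycle_edge_redundant T x y s :
  ucycle (adj T) [:: x, y & s] -> (0 < size s)%N ->
  connect (adj (T :\ [set x; y])) y x.
Proof.
case/andP; rewrite /= rcons_path => /and3P[_ ps lx].
rewrite !inE negb_or => /andP[/andP[xy xs]] /andP[ys us] s0.
have nlast : last y s != y.
  case: s s0 ys {ps lx xs us} => //= z s _.
  by apply: contra => /eqP <-; exact: mem_last.
apply: (@connect_trans _ _ (last y s)); last first.
  apply: connect1; rewrite /adj !inE -[X in _ && X]/(adj T _ _) lx andbT.
  apply/eqP => /setP /(_ y).
  by rewrite !inE eqxx orbT (eq_sym y) (negbTE nlast) eq_sym (negbTE xy).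
apply/connectP; exists s => //.
(* The path along [s] never visits [x], so none of its edges is the deleted one. *)
have : x \notin y :: s by rewrite inE negb_or xy.
elim: s {1 2 4}y {xs ys us s0 nlast lx} ps => //= z s IHs w /andP[wz ps].
rewrite inE negb_or => /andP[xw xzs]; rewrite IHs // andbT.
rewrite /adj !inE -[X in _ && X]/(adj T _ _) wz andbT.
apply/eqP => /setP /(_ x).
by move: xzs; rewrite !inE negb_or eqxx (negbTE xw) => /andP[/negbTE-> _].
Qed.

(** An inclusion-minimal connected subgraph is acyclic, since an edge on a cycle could be
    removed. *)
Lemma connected_spanning_tree T :
  T \subset edges V -> connected T ->
  exists2 T' : {set {set V}}, T' \subset T & spanning_tree T'.
Proof.
pose P T := [forall i, forall j, connect (adj T) i j].
have PP T0 : reflect (connected T0) (P T0).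
  apply: (iffP forallP) => [h i j | h i]; first by move/forallP: (h i); apply.
  by apply/forallP => j; apply: h.
move=> sTE /PP /minset_exists[T' /minsetP[/PP cT' minT'] sT'T].
exists T' => //; split; rewrite ?(subset_trans sT'T) // => s.
rewrite leqNgt; case: s => [|x [|y s]] // cyc; apply/negP => /= sz.
have cyx := cycle_edge_redundant cyc sz.
have xyT : [set x; y] \in T' by case/andP: cyc => /andP[].
have : P (T' :\ [set x; y]).
  apply/PP => i j; apply: connect_sub (cT' i j) => a b ab.
  have [eab | nab] := eqVneq [set a; b] [set x; y]; last first.
    by apply: connect1; rewrite /adj !inE nab.
  have : a \in [set x; y] by rewrite -eab !inE eqxx.
  have : b \in [set x; y] by rewrite -eab !inE eqxx orbT.
  by rewrite !inE => /orP[] /eqP-> /orP[] /eqP->; rewrite ?connect0 // connect_adj_sym.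
move/minT'; rewrite subD1set => /(_ isT) e.
by move: xyT; rewrite -e !inE eqxx.
Qed.

(** Induction on the edges: starting from distinct labels, each further edge identifies the labels
    of its two ends, which loses at most one label. *)
Lemma edge_labelling (F : {set {set V}}) : F \subset edges V ->
  exists f : V -> V, (forall i j, [set i; j] \in F -> f i = f j) /\
    (#|V| <= #|[set f i | i : V]| + #|F|)%N.
Proof.
elim: {F}#|F| {-2}F (erefl #|F|) => [|m IHm] F cF sF.
  exists id; split=> [i j|]; last by rewrite card_imset ?leq_addr.
  by move/eqP: cF; rewrite cards_eq0 => /eqP->; rewrite inE.
have /set0Pn[e eF] : F != set0 by rewrite -card_gt0 cF.
have cF' : #|F :\ e| = m by move: (cardsD1 e F); rewrite eF cF => -[].
have [f [fF card_f]] := IHm _ cF' (subset_trans (subD1set F e) sF).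
have := subsetP sF e eF; rewrite inE => /cards2P[a [b [ab ee]]].
pose g x := if f x == f a then f b else f x.
exists g; split=> [i j ijF|].
  have [ije | nije] := eqVneq [set i; j] e; last first.
    by rewrite /g (fF i j) // !inE nije.
  have : i \in e by rewrite -ije !inE eqxx.
  have : j \in e by rewrite -ije !inE eqxx orbT.
  rewrite ee /g !inE => /orP[] /eqP-> /orP[] /eqP->; rewrite ?eqxx //.
    by case: eqP.
  by case: eqP.
have : [set f i | i : V] :\ f a \subset [set g i | i : V].
  apply/subsetP => y; rewrite !inE => /andP[ya /imsetP[x _ yx]].
  by apply/imsetP; exists x => //; rewrite /g -yx (negbTE ya).
move/subset_leq_card; move: (cardsD1 (f a) [set f i | i : V]) card_f.
rewrite imset_f // cF' cF; lia.
Qed.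

End Graph.

(** With the edges as [A] and the colouring as [f], [B] keeps exactly one edge of each colour. *)
Lemma imset_section (aT rT : finType) (f : aT -> rT) (A : {set aT}) :
  exists B : {set aT},
    [/\ B \subset A, {in B &, injective f} & f @: B = f @: A].
Proof.
pose r y := [pick x in A | f x == y].
exists [set x in A | r (f x) == Some x]; split.
- by apply/subsetP => x; rewrite inE => /andP[].
- move=> x y; rewrite !inE => /andP[_ /eqP rx] /andP[_ /eqP ry] fxy.
  by move: rx; rewrite fxy ry => -[].
apply/eqP; rewrite eqEsubset; apply/andP; split.
  by apply: imsetS; apply/subsetP => x; rewrite inE => /andP[].
apply/subsetP => _ /imsetP[x xA ->].
(* Only the left side is unfolded, so the case analysis records that [z] is the element chosen for
   [f x]. *)
have : r (f x) = r (f x) by [].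
rewrite {1}/r; case: pickP => [z /andP[zA /eqP fz] rz | /(_ x)]; last first.
  by rewrite xA eqxx.
by apply/imsetP; exists z; rewrite // inE zA fz -rz eqxx.
Qed.

(** * Orientation of three points *)

Section Orientation.
Local Open Scope ring_scope.
Variable R : realType.
Implicit Types p q x y : 'rV[R]_2.

(** Twice the signed area of the triangle [p], [q], [x]; its sign tells on which side of the line
    through [p] and [q] the point [x] lies. *)
Definition orient p q x : R :=
  (q 0 0 - p 0 0) * (x 0 1 - p 0 1) - (q 0 1 - p 0 1) * (x 0 0 - p 0 0).

Lemma orient_segment p q x y t :
  orient p q ((1 - t) *: x + t *: y) = (1 - t) * orient p q x + t * orient p q y.
Proof. by rewrite /orient !mxE; ring. Qed.

Lemma orientl p q : orient p q p = 0. Proof. by rewrite /orient; ring. Qed.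

Lemma orientr p q : orient p q q = 0. Proof. by rewrite /orient; ring. Qed.

Lemma orient0_collinear p q x : p != q -> orient p q x = 0 -> collinear p q x.
Proof.
move=> pq o0; exists p, (q - p); split; first by rewrite subr_eq0 eq_sym.
- by exists 0; rewrite // scale0r addr0.
- by exists 1; rewrite // scale1r addrC subrK.
have rowP2 (u w : 'rV[R]_2) : u 0 0 = w 0 0 -> u 0 1 = w 0 1 -> u = w.
  move=> e0 e1; apply/rowP => k; case: k => [[|[|//]]] lk.
  - by rewrite (_ : Ordinal lk = 0) //; apply: val_inj.
  - by rewrite (_ : Ordinal lk = 1) //; apply: val_inj.
(* The parameter of [x] on the line is read off in a coordinate where [p] and [q] differ. *)
have [q0 | q0] := eqVneq (q 0 0 - p 0 0) 0; last first.
  exists ((x 0 0 - p 0 0) / (q 0 0 - p 0 0)) => //.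
  apply: rowP2; rewrite !mxE; first by field.
  rewrite -[RHS](subrK (p 0 1)) addrC; congr (_ + _); apply: (mulfI q0).
  by move/subr0_eq: o0 => ->; field.
have q1 : q 0 1 - p 0 1 != 0.
  apply: contra pq => /eqP q1; apply/eqP/rowP2; lra.
exists ((x 0 1 - p 0 1) / (q 0 1 - p 0 1)) => //.
apply: rowP2; rewrite !mxE; last by field.
move: o0; rewrite /orient q0 mul0r mulr0 addr0 sub0r => /eqP.
by rewrite oppr_eq0 mulf_eq0 (negbTE q1) subr_eq0 => /eqP->.
Qed.

End Orientation.

(** * Edges and the line through two vertices *)

Section PlaneGraph.
Local Open Scope ring_scope.
Variables (R : realType) (V : finType) (pt : V -> 'rV[R]_2).
Hypothesis gp : general_position pt.
Implicit Types (e f S A : {set V}) (T : {set {set V}}).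

Let side v q i := orient (pt v) (pt q) (pt i).

Lemma side_eq0 v q i : v != q -> side v q i = 0 -> i \in [set v; q].
Proof.
move=> vq /orient0_collinear o0; rewrite !inE.
case: eqVneq => //= iv; case: eqVneq => //= iq.
case: (gp.2 v q i vq); rewrite 1?eq_sym //; apply: o0.
by apply: contra vq => /eqP /gp.1 ->.
Qed.

Lemma edge_segment_line v q x :
  edge_segment pt [set v; q] x -> orient (pt v) (pt q) x = 0.
Proof.
case=> i [j [ij [t _ <-]]]; rewrite orient_segment -!/(side v q _).
have side0 m : m \in [set v; q] -> side v q m = 0.
  by rewrite !inE /side => /orP[] /eqP->; rewrite ?orientl ?orientr.
by rewrite !side0 ?mulr0 ?addr0 // ij !inE eqxx ?orbT.
Qed.

(** Nonnegative products put [e] in one closed half-plane, whichever it is. An inner point of such a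
    segment is on the line only if both ends are, and general position leaves only [v] and [q]
    there. *)
Lemma edge_segment_meets_line v q e x : v != q ->
  {in e &, forall i j, 0 <= side v q i * side v q j} ->
  edge_segment pt e x -> orient (pt v) (pt q) x = 0 ->
  e = [set v; q] \/ exists2 k, k \in e :&: [set v; q] & x = pt k.
Proof.
move=> vq pos [i [j [ee [t /= /andP[t0 t1] xt]]]] x0; subst e.
have {pos} pos : 0 <= side v q i * side v q j by apply: pos; rewrite !inE eqxx ?orbT.
move: x0; rewrite -xt orient_segment -/(side v q i) -/(side v q j) => x0.
have [te | tn0] := eqVneq t 0.
  subst t; right; exists i; last by rewrite subr0 scale1r scale0r addr0.
  rewrite in_setI set21; apply: side_eq0 => //.
  by move: x0; rewrite subr0 mul1r mul0r addr0.
have [te | tn1] := eqVneq t 1.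
  subst t; right; exists j; last by rewrite subrr scale1r scale0r add0r.
  rewrite in_setI set22; apply: side_eq0 => //.
  by move: x0; rewrite subrr mul1r mul0r add0r.
have {}t0 : 0 < t by rewrite lt_def tn0.
have {}t1 : 0 < 1 - t by rewrite subr_gt0 lt_def eq_sym tn1.
(* Multiplying [x0] by [side v q i] gives a vanishing sum of two nonnegative terms, the first a
   positive multiple of a square. *)
have i0 : side v q i = 0.
  apply/eqP; rewrite -sqrf_eq0; apply/eqP.
  have : (1 - t) * side v q i ^+ 2 + t * (side v q i * side v q j) = 0.
    by rewrite -[RHS](mulr0 (side v q i)) -x0; ring.
  have a0 := mulr_ge0 (ltW t1) (sqr_ge0 (side v q i)).
  move/eqP; rewrite paddr_eq0 ?(mulr_ge0 (ltW t0) pos) // => /andP[+ _].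
  by rewrite mulf_eq0 (gt_eqF t1) /= => /eqP.
have j0 : side v q j = 0.
  by move/eqP: x0; rewrite i0 mulr0 add0r mulf_eq0 (gt_eqF t0) /= => /eqP.
have iv := side_eq0 vq i0; have jv := side_eq0 vq j0.
(* Here [e] may be a singleton, whose segment is one point. *)
have [ij | ij] := eqVneq i j.
  right; exists i; first by rewrite inE iv !inE eqxx.
  by rewrite ij -scalerDl subrK scale1r.
left; apply/eqP; rewrite eqEcard !cards2 vq ij andbT.
by apply/subsetP => k; rewrite !inE => /orP[] /eqP->; rewrite -in_set2.
Qed.

(** A common point lies in both closed half-planes, hence on the line. There each edge either joins
    [v] to [q] or contributes only a vertex; as [e] and [f] differ, the point is a shared vertex. *)
Lemma separated_not_crossing v q e f : v != q -> e != f ->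
  {in e, forall i, 0 <= side v q i} -> {in f, forall i, side v q i <= 0} ->
  ~ crossing pt e f.
Proof.
move=> vq ef eL fR [x [ex fx nx]].
have x0 : orient (pt v) (pt q) x = 0.
  apply/eqP; rewrite eq_le; apply/andP; split.
    case: fx => [i [j [fe [t /= /andP[t0 t1] <-]]]]; rewrite orient_segment.
    have : side v q i <= 0 by apply: fR; rewrite fe !inE eqxx.
    have : side v q j <= 0 by apply: fR; rewrite fe !inE eqxx orbT.
    rewrite /side; nra.
  case: ex => [i [j [ee [t /= /andP[t0 t1] <-]]]]; rewrite orient_segment.
  have : 0 <= side v q i by apply: eL; rewrite ee !inE eqxx.
  have : 0 <= side v q j by apply: eL; rewrite ee !inE eqxx orbT.
  rewrite /side; nra.
have [|ee|[k kv xk]] := edge_segment_meets_line vq _ ex x0.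
- by move=> i j ie je; rewrite mulr_ge0 ?eL.
- have [|fe|[k kv xk]] := edge_segment_meets_line vq _ fx x0.
  + by move=> i j ie je; rewrite mulr_le0 ?fR.
  + by rewrite ee fe eqxx in ef.
  + by apply: nx; exists k; rewrite // ee setIC.
have [|fe|[l lv xl]] := edge_segment_meets_line vq _ fx x0.
- by move=> i j ie je; rewrite mulr_le0 ?fR.
- by apply: nx; exists k; rewrite // fe.
apply: nx; exists k => //; move: kv lv; rewrite !inE.
have -> : l = k by apply: gp.1; rewrite -xl.
by move=> /andP[-> _] /andP[-> _].
Qed.

Lemma crossing_sym e f : crossing pt e f -> crossing pt f e.
Proof. by case=> x [ex fx nx]; exists x; split; rewrite 1?setIC. Qed.

(** * Plane graphs whose edges join different labels *)

Variables (L : eqType) (lab : V -> L).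

Definition bichromatic S : {set {set V}} :=
  [set e | [exists i in S, exists j in S, (lab i != lab j) && (e == [set i; j])]].

Lemma bichromaticP S e :
  reflect (exists i j, [/\ i \in S, j \in S, lab i != lab j & e = [set i; j]])
          (e \in bichromatic S).
Proof.
rewrite inE; apply: (iffP exists_inP) => [[i iS /exists_inP[j jS]] | [i [j [iS jS lij ->]]]].
  by case/andP=> lij /eqP->; exists i, j.
by exists i => //; apply/exists_inP; exists j; rewrite ?lij ?eqxx.
Qed.

Lemma bichromatic_edges S : bichromatic S \subset edges V.
Proof.
apply/subsetP => e /bichromaticP[i [j [_ _ lij ->]]].
by rewrite inE cards2 (contraNneq _ lij) // => ->.
Qed.

Lemma bichromaticS S S' : S \subset S' -> bichromatic S \subset bichromatic S'.
Proof.
move=> sS; apply/subsetP => e /bichromaticP[i [j [iS jS lij ->]]].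
by apply/bichromaticP; exists i, j; split; rewrite ?(subsetP sS).
Qed.

Lemma bichromatic_sub S e : e \in bichromatic S -> e \subset S.
Proof. by case/bichromaticP=> i [j [iS jS _ ->]]; rewrite subUset !sub1set iS. Qed.

(** Relative to the line through [v] and [i], another edge at [v] has an end on the line, so it lies
    in a closed half-plane wherever its other end is. *)
Lemma plane_star v A : v \notin A -> plane pt [set [set v; i] | i in A].
Proof.
move=> vA e e' /imsetP[i iA ->] /imsetP[j jA ->] ne [x [ex jx nx]].
have vi : v != i by apply: contraNneq vA => ->.
have x0 := edge_segment_line ex.
have [|e1|[k kv xk]] := edge_segment_meets_line vi _ jx x0.
- move=> k l; rewrite !inE => /orP[] /eqP-> /orP[] /eqP->;
  by rewrite /side ?orientl ?mul0r ?mulr0 // -expr2 sqr_ge0.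
- by rewrite e1 eqxx in ne.
- by apply: nx; exists k; rewrite // setIC.
Qed.

(** The new edge lies on the line bounding a closed half-plane that contains [T], and no edge of [T]
    equals it because [v] is outside [A]. *)
Lemma plane_add_edge v q A T : v \notin A -> q \in A ->
  {in A &, forall i j, 0 <= side v q i * side v q j} ->
  T \subset bichromatic A -> plane pt T -> plane pt ([set v; q] |: T).
Proof.
move=> vA qA pos sT pT.
have vq : v != q by apply: contraNneq vA => ->.
have step e : e \in T -> ~ crossing pt e [set v; q].
  move=> eT [x [ex vqx nx]].
  have sA := bichromatic_sub (subsetP sT e eT).
  have x0 := edge_segment_line vqx.
  have [|e1|[k kv xk]] := edge_segment_meets_line vq _ ex x0.
  - by move=> k l /(subsetP sA) kA /(subsetP sA) lA; apply: pos.
  - by case/negP: vA; apply: (subsetP sA); rewrite e1 !inE eqxx.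
  - by apply: nx; exists k.
move=> e e'; rewrite !in_setU1 => /orP[/eqP->|eT] /orP[/eqP->|eT'] ne //.
- by rewrite eqxx in ne.
- by move/crossing_sym; apply: step.
- exact: step.
- exact: pT.
Qed.

(** The induction hypothesis is a premise and the side is left open by the products, so one argument
    serves both half-planes. *)
Lemma halfplane_bichromatic_graph v q A : v \notin A -> q \in A -> lab v != lab q ->
  {in A &, forall i j, 0 <= side v q i * side v q j} ->
  ((exists2 i, i \in A & lab i != lab q) ->
    exists T, [/\ T \subset bichromatic A, plane pt T & spans T A]) ->
  exists T, [/\ T \subset bichromatic (v |: A), plane pt T & spans T (v |: A)].
Proof.
move=> vA qA lvq pos IH.
have vqE : [set v; q] \in bichromatic (v |: A).
  by apply/bichromaticP; exists v, q; rewrite !inE eqxx qA orbT.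
have [/exists_inP/IH[T [sT pT cT]] | ] := boolP [exists i in A, lab i != lab q].
  exists ([set v; q] |: T); split.
  - by rewrite subUset sub1set vqE (subset_trans sT) // bichromaticS // subsetUr.
  - exact: (plane_add_edge vA qA pos sT pT).
  apply: (@spans_root _ _ _ q) => i; rewrite !inE => /orP[/eqP->|iA].
    by apply: connect1; rewrite /adj setUC setU11.
  by apply: connect_adjS (cT q i qA iA); rewrite subsetUr.
rewrite negb_exists_in => /forall_inP lA.
exists [set [set v; i] | i in A]; split.
- apply/subsetP => _ /imsetP[i iA ->]; apply/bichromaticP; exists v, i.
  by rewrite !inE eqxx iA orbT; split=> //; move: (lA i iA); rewrite negbK => /eqP->.
- exact: plane_star.
apply: (@spans_root _ _ _ v) => i; rewrite !inE => /orP[/eqP->|iA].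
  exact: connect0.
by apply: connect1; apply: imset_f.
Qed.

Lemma bichromatic_plane_graph S v q : v \in S -> q \in S -> lab v != lab q ->
  exists T, [/\ T \subset bichromatic S, plane pt T & spans T S].
Proof.
elim: {S}#|S|.+1 {-2}S (ltnSn #|S|) v q => // m IHm S cS v q vS qS lvq.
have vq : v != q by apply: contraNneq lvq => ->.
have half (P : pred V) : P q ->
    {in P &, forall i j, 0 <= side v q i * side v q j} ->
    exists T, [/\ T \subset bichromatic (v |: [set i in S :\ v | P i]),
      plane pt T & spans T (v |: [set i in S :\ v | P i])].
  move=> Pq pos; set A := [set i in _ | _].
  have sA : A \subset S :\ v by apply/subsetP => i; rewrite inE => /andP[].
  have qA : q \in A by rewrite !inE eq_sym vq qS.
  apply: (halfplane_bichromatic_graph _ qA lvq); first by rewrite !inE eqxx.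
    by move=> i j; rewrite !inE => /andP[_ Pi] /andP[_ Pj]; apply: pos.
  (* Without [v], the set [A] is smaller than [S]; [i] and [q] supply its two labels. *)
  case=> i iA liq; apply: (IHm A _ i q) => //.
  rewrite (leq_ltn_trans (subset_leq_card sA)) // -ltnS (leq_trans _ cS) //.
  by rewrite [#|S|](cardsD1 v) vS.
have [|i j|T1 [sT1 pT1 cT1]] := half (fun i => 0 <= side v q i).
- by rewrite /side orientr.
- by rewrite -!topredE /=; apply: mulr_ge0.
have [|i j|T2 [sT2 pT2 cT2]] := half (fun i => side v q i <= 0).
- by rewrite /side orientr.
- by rewrite -!topredE /=; apply: mulr_le0.
have subS (P : pred V) : v |: [set i in S :\ v | P i] \subset S.
  by apply/subsetP => i; rewrite !inE => /orP[/eqP->|/andP[/andP[]]].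
have sep e e' : e \in T1 -> e' \in T2 -> e != e' -> ~ crossing pt e e'.
  move=> /(subsetP sT1)/bichromatic_sub/subsetP e1.
  move=> /(subsetP sT2)/bichromatic_sub/subsetP e2 ne.
  apply: (separated_not_crossing vq) => // i.
    by move/e1; rewrite !inE => /orP[/eqP->|/andP[]] //; rewrite /side orientl.
  by move/e2; rewrite !inE => /orP[/eqP->|/andP[]] //; rewrite /side orientl.
exists (T1 :|: T2); split.
- by rewrite subUset !(subset_trans sT1, subset_trans sT2) ?bichromaticS.
- move=> e e'; rewrite !in_setU => /orP[]eT /orP[]eT' ne.
  + exact: pT1.
  + exact: sep.
  + by move/crossing_sym; apply: sep; rewrite // eq_sym.
  + exact: pT2.
apply: (@spans_root _ _ _ v) => i iS.
have [-> | iv] := eqVneq i v; first exact: connect0.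
have [i0 | i0] := leP 0 (side v q i).
  apply: (connect_adjS (subsetUl T1 T2)).
  by apply: cT1; rewrite !inE ?eqxx // iv iS i0 orbT.
apply: (connect_adjS (subsetUr T1 T2)).
by apply: cT2; rewrite !inE ?eqxx // iv iS (ltW i0) orbT.
Qed.

End PlaneGraph.

(** * Counting the omitted edges and extracting the tree *)

Theorem theorem3 (R : realType) (n : nat) (pt : 'I_n -> 'rV[R]_2)
    (C : finType) (c : {set 'I_n} -> C)
    (hn : 3 <= n)
    (hpt : general_position pt)
    (hc : #|[set c e | e in edges 'I_n]| = 'C(n, 2) - n + 2) :
  exists T : {set {set 'I_n}},
    [/\ spanning_tree T, plane pt T & heterochromatic c T].
Proof.
have [G [sG injG imG]] := imset_section c (edges 'I_n).
have cE : #|edges 'I_n| = 'C(n, 2) by rewrite card_draws card_ord.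
have cF : #|edges 'I_n :\: G| + 2 <= n.
  rewrite cardsD (setIidPr sG) cE -(card_in_imset injG) imG hc.
  (* The subtraction in [hc] is truncated; this bound, which rests on [hn], makes it a genuine
     one. *)
  have : n <= 'C(n, 2) by rewrite bin2 -[n]doubleK half_leq // -muln2; nia.
  by lia.
have [f [fF cf]] := edge_labelling (subsetDl (edges 'I_n) G).
(* Labels and omitted edges together number at least [n], and at most [n - 2] edges are omitted. *)
have : 1 < #|[set f i | i : 'I_n]|.
  rewrite ltnNge; apply/negP => le1.
  by move: (leq_trans cf (leq_add le1 (leqnn _))); rewrite card_ord; lia.
case/card_gt1P => _ [_ [/imsetP[v _ ->] /imsetP[q _ ->] fvq]].
have [T [sT pT cT]] := bichromatic_plane_graph hpt (in_setT v) (in_setT q) fvq.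
(* The ends of an omitted edge share a label, so a bichromatic edge is a kept one. *)
have sTG : T \subset G.
  apply/subsetP => e /(subsetP sT) eB.
  have eE := subsetP (bichromatic_edges _ _) _ eB.
  case/bichromaticP: eB eE => i [j [_ _ fij ->]] eE.
  by apply: contraNT fij => nG; rewrite (fF i j) // inE nG.
(* Planarity and distinctness of colours both pass to subgraphs, so any spanning tree of [T] will
   do. *)
have [|i j|T' sT' tT'] := @connected_spanning_tree _ T.
- exact: subset_trans sTG sG.
- by apply: cT; rewrite inE.
exists T'; split=> // [e e' eT eT'|e e' eT eT'].
  by apply: pT; apply: (subsetP sT').
by apply: injG; apply: (subsetP sTG); apply: (subsetP sT').
Qed.
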